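(* Let $F$ be a field of characteristic $p>0$ and let $L$ be a Lie algebra of dimension $n$ over $F$. Then $L$ has a faithful completely reducible module $V$ with $\dim(V) \le p^{n^2-1}$.
   Context: An $L$-module is faithful if the corresponding representation $L \to \mathfrak{gl}(V)$ is injective; it is completely reducible if it is a direct sum of irreducible $L$-modules. All dimensions are over $F$. *)

(* Defs.v *)
From HB Require Import structures.
From mathcomp Require Import all_boot all_order all_algebra.

Set Implicit Arguments.
Unset Strict Implicit.
Unset Printing Implicit Defensive.

Import GRing.Theory.
Local Open Scope ring_scope.

HB.mixin Record Lmodule_isLieAlgebra (F : fieldType) L of GRing.Lmodule F L := {
  lie : L -> L -> L;
  lie_linearl : forall y : L, linear (fun x : L => lie x y);
  lie_linearr : forall x : L, linear (fun y : L => lie x y);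
  liexx : forall x : L, lie x x = 0;
  lie_jacobi : forall x y z : L,
    lie x (lie y z) + lie y (lie z x) + lie z (lie x y) = 0
}.

#[short(type="lieAlgType")]
HB.structure Definition LieAlgebra (F : fieldType) :=
  { L of Lmodule_isLieAlgebra F L & GRing.Lmodule F L }.

#[short(type="finLieAlgType")]
HB.structure Definition FinLieAlgebra (F : fieldType) :=
  { L of Lmodule_isLieAlgebra F L & Vector F L }.

Definition lie_morphism (F : fieldType) (L M : lieAlgType F) (f : L -> M) :=
  {morph f : x y / lie x y}.

(* 'End(V) with the commutator bracket is gl(V). *)
Section GeneralLinear.
Variables (F : fieldType) (V : vectType F).
Implicit Types f g h : 'End(V).

Definition commutator_lfun f g : 'End(V) := (f \o g)%VF - (g \o f)%VF.

Fact commutator_lfun_linearl g : linear (fun f => commutator_lfun f g).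
Proof.
move=> a f h; rewrite /commutator_lfun comp_lfunDl comp_lfunDr.
by rewrite -comp_lfunZl -comp_lfunZr opprD addrACA -scalerBr.
Qed.

Fact commutator_lfun_linearr f : linear (fun g => commutator_lfun f g).
Proof.
move=> a g h; rewrite /commutator_lfun comp_lfunDl comp_lfunDr.
by rewrite -comp_lfunZl -comp_lfunZr opprD addrACA -scalerBr.
Qed.

Fact commutator_lfun_xx f : commutator_lfun f f = 0.
Proof. exact: subrr. Qed.

Fact commutator_lfun_jacobi f g h :
  commutator_lfun f (commutator_lfun g h)
  + commutator_lfun g (commutator_lfun h f)
  + commutator_lfun h (commutator_lfun f g) = 0.
Proof.
have cancel6 (a b c d e r : 'End(V)) :
  a - b - (c - d) + (c - e - (r - b)) + (r - d - (a - e)) = 0.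
  have subrBB (x y z t : 'End(V)) : x - y - (z - t) = x + t - (z + y).
    by rewrite opprB addrACA -opprD (addrC y).
  by rewrite !subrBB !subrKA subrr.
rewrite /commutator_lfun !(comp_lfunDl, comp_lfunDr, comp_lfunNl, comp_lfunNr).
by rewrite !comp_lfunA; exact: cancel6.
Qed.

HB.instance Definition _ := Lmodule_isLieAlgebra.Build F 'End(V)
  commutator_lfun_linearl commutator_lfun_linearr commutator_lfun_xx
  commutator_lfun_jacobi.

End GeneralLinear.

Section Modules.
(* An L-module structure on V is given by its representation                  *)
(* rho : L -> 'End(V), which is required to be linear with lie_morphism rho.  *)
Variables (F : fieldType) (L : lieAlgType F) (V : vectType F).
Variable rho : L -> 'End(V).

Definition submodule (U : {vspace V}) := forall x : L, (rho x @: U <= U)%VS.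

Definition irreducible_submodule (U : {vspace V}) :=
  [/\ submodule U, U != 0%VS &
      forall W : {vspace V}, submodule W -> (W <= U)%VS -> W = 0%VS \/ W = U].

(* The empty direct sum (m = 0) is allowed: the zero module is completely     *)
(* reducible. Finite families suffice because V is finite-dimensional.        *)
Definition completely_reducible :=
  exists (m : nat) (U : 'I_m -> {vspace V}),
    [/\ forall i, irreducible_submodule (U i),
        directv (\sum_(i < m) U i) & (\sum_(i < m) U i)%VS = fullv].

End Modules.

(* Main.v *)
Require Import Defs.
From Stdlib Require Import Classical.
From HB Require Import structures.
From mathcomp Require Import all_boot all_order all_algebra ring zify.

(* It is enough to find, for every x <> 0 in L, an irreducible module of       *)
(* dimension at most p^(n(n-1)) on which x does not act as 0: adding such       *)
(* modules one at a time for x in the current kernel, at most n of them make    *)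
(* the direct sum faithful, and n p^(n(n-1)) <= p^(n^2-1).                      *)
(* Choose a basis x_1, ..., x_n of L containing x. As ad x_i is singular, its   *)
(* characteristic polynomial divides some p-polynomial P_i, monic of degree     *)
(* q = p^(n-1), and then P_i(x_i) is central in U(L). The module needed is the  *)
(* dual of the quotient of U(L) by the relations P_i(x_i) = 1, of dimension     *)
(* q^n: it consists of the functions phi on words in x_1, ..., x_n with         *)
(*   phi(u x_i x_j v) - phi(u x_j x_i v) = phi(u [x_i, x_j] v)   and            *)
(*   phi(u P_i(x_i) v) = phi(u v),                                              *)
(* where x_i acts by (x_i phi)(w) = phi(w x_i). By the PBW theorem the first    *)
(* relation allows arbitrary values on sorted words, and since P_i(x_i) is      *)
(* central the second one reduces to a linear recurrence in each exponent.      *)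
(* On a minimal submodule P(x) = 1 for a p-polynomial P, so x does not act as 0.*)

(** Nonvanishing of x comes from P(x) acting as the identity although the p-polynomial P has no
    constant term: if x killed a nonzero subspace, so would P(x) ([reduced_repr_neq0]). This holds
    for every nonzero subspace, so it survives the passage to a minimal submodule ([simple_module]).

    The degree of P_i is bounded in [ppoly_multiple]: ad x_i kills x_i, so 0 is a root of its
    characteristic polynomial, and this saves one power of p. [insert_ppoly_central] turns P_i(ad
    x_i) = 0 into centrality of P_i(x_i).

    That the module has the full dimension is PBW, proved as a diamond lemma for functionals on
    words ([pbw_extension_rel]), combined with the recurrences in the exponents: by
    [extension_normal] and [extension_unique], a reduced functional is the same as an arbitrary
    function on exponent vectors with entries below q. [completely_reducible_small_kernel] then adds
    up simple modules. Where the basis is written with n + 1 vectors, q is p^n and the reduced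
    module has dimension p^(n(n+1)). *)

Set Implicit Arguments.
Unset Strict Implicit.
Unset Printing Implicit Defensive.

Import Order.TTheory GRing.Theory Num.Theory.
Local Open Scope ring_scope.

(** * Words and the PBW extension *)

Section Words.
Variables (F : fieldType) (n : nat).
Implicit Types (i j k a b d e : 'I_n) (u v w t : seq 'I_n) (phi psi : seq 'I_n -> F).

Definition letter_le : rel 'I_n := fun i j => (i <= j)%N.

Lemma letter_le_trans : transitive letter_le.
Proof. by move=> j i k; apply: leq_trans. Qed.

Fixpoint inversions w : nat :=
  if w is i :: w' then count (fun j : 'I_n => (j < i)%N) w' + inversions w'
  else 0.

(** The rightmost descent is chosen; confluence shows later that the choice is immaterial. *)
Fixpoint descent w : option (seq 'I_n * 'I_n * 'I_n * seq 'I_n) :=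
  if w is i :: w' then
    if descent w' is Some (u, a, b, v) then Some (i :: u, a, b, v)
    else if w' is j :: v then
      if (j < i)%N then Some ([::], i, j, v) else None
    else None
  else None.

Lemma descentP w u i j v :
  descent w = Some (u, i, j, v) -> w = u ++ [:: i, j & v] /\ (j < i)%N.
Proof.
elim: w u => [|a w IHw] u //=.
case: (descent w) IHw => [[[[u' a'] b'] v'] IHw|_].
  by case=> <- Ea Eb Ev; rewrite Ea Eb Ev in IHw; have [-> ->] := IHw _ erefl.
case: w => // b w; case: ifP => // ltba [<- <- <- <-].
by split.
Qed.

Lemma descent_sorted w : descent w = None -> sorted letter_le w.
Proof.
elim: w => [|a w IHw] //=.
case: (descent w) IHw => [[[[? ?] ?] ?]|] // IHw.
case: w IHw => // b w IHw; case: ltnP => // leab _ /=.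
by rewrite /letter_le leab; apply: IHw.
Qed.

Lemma sorted_no_descent u i j v :
  sorted letter_le (u ++ [:: i, j & v]) -> (j < i)%N = false.
Proof.
elim: u => [|a u IHu] /=; first by case/andP => leij _; apply/negbTE; rewrite -leqNgt.
by move/path_sorted.
Qed.

Lemma inversions_swap u i j v : (j < i)%N ->
  inversions (u ++ [:: i, j & v]) = (inversions (u ++ [:: j, i & v])).+1.
Proof.
move=> ltji; elim: u => [|a u IHu] /=.
  by rewrite ltji ltnNge (ltnW ltji) /= add1n add0n addSn addnCA.
by rewrite {}IHu addnS !count_cat /= [X in (_ + X + _)%N]addnCA.
Qed.

Section Bracket.
Variable c : 'I_n -> 'I_n -> 'I_n -> F.
Implicit Types f : 'I_n -> F.

Definition insert_vec phi u f v := \sum_k f k * phi (u ++ k :: v).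

Definition bracket_rel_at phi u i j v :=
  phi (u ++ [:: i, j & v]) = phi (u ++ [:: j, i & v]) + insert_vec phi u (c i j) v.

Definition bracket_rel phi := forall u i j v, bracket_rel_at phi u i j v.

(* [m] is fuel; each swap removes exactly one inversion, so [inversions w] is  *)
(* precisely enough.                                                          *)
Fixpoint bubble (g psi : seq 'I_n -> F) m w : F :=
  if m is m'.+1 then
    if descent w is Some (u, i, j, v)
    then bubble g psi m' (u ++ [:: j, i & v]) + insert_vec g u (c i j) v
    else psi w
  else psi w.

(** Layer [s] is meant for words of length [s]: swaps keep the length, and bracket terms, one letter
    shorter, are read from the previous layer. At [s = 0] the lower layer [psi] is a dummy, as the
    empty word has no descent. *)
Fixpoint pbw_layer psi s : seq 'I_n -> F := fun w =>
  bubble (if s is s'.+1 then pbw_layer psi s' else psi) psi (inversions w) w.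

Definition pbw_extension psi w := pbw_layer psi (size w) w.

Lemma sorted_descent w : sorted letter_le w -> descent w = None.
Proof.
case Dw: (descent w) => [[[[u i] j] v]|//].
by have [-> ltji] := descentP Dw => /sorted_no_descent; rewrite ltji.
Qed.

Lemma pbw_extension_sorted psi w :
  sorted letter_le w -> pbw_extension psi w = psi w.
Proof.
move=> w_sorted; rewrite /pbw_extension; case: (size w) => [|d] /=;
  by case: (inversions w) => //= m; rewrite sorted_descent.
Qed.

(** Holds by construction: unfolding [bubble] once spends one unit of fuel, and the swap removes one
    inversion, so the fuel is again exact. *)
Lemma pbw_extension_descent psi w u i j v : descent w = Some (u, i, j, v) ->
  bracket_rel_at (pbw_extension psi) u i j v.
Proof.
move=> Dw; have [Ew ltji] := descentP Dw.
rewrite /bracket_rel_at -Ew /pbw_extension.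
have sz k : size (u ++ k :: v) = (size u + size v).+1 by rewrite size_cat addnS.
have -> : size w = (size u + size v).+2 by rewrite Ew size_cat /= !addnS.
have -> : size (u ++ [:: j, i & v]) = (size u + size v).+2.
  by rewrite size_cat /= !addnS.
rewrite [LHS]/=.
have -> : inversions w = (inversions (u ++ [:: j, i & v])).+1.
  by rewrite Ew inversions_swap.
rewrite [LHS]/= Dw; congr (_ + _).
by apply: eq_bigr => k _; rewrite sz.
Qed.

Hypothesis c_alt : forall i k, c i i k = 0.
Hypothesis c_anti : forall i j k, c i j k = - c j i k.
Hypothesis c_jacobi : forall a b d m,
  \sum_l (c b d l * c l a m + c d a l * c l b m + c a b l * c l d m) = 0.

Lemma bracket_rel_refl phi u i v : bracket_rel_at phi u i i v.
Proof.
rewrite /bracket_rel_at /insert_vec big1 ?addr0 // => k _.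
by rewrite c_alt mul0r.
Qed.

Lemma bracket_rel_sym phi u i j v :
  bracket_rel_at phi u i j v -> bracket_rel_at phi u j i v.
Proof.
rewrite /bracket_rel_at => ->; rewrite -addrA -big_split /= big1 ?addr0 // => k _.
by rewrite (c_anti i j) mulNr addNr.
Qed.

(** Case split for confluence; only the middle case, where the two pairs share a letter, is a
    genuine critical pair. *)
Lemma two_descents u1 i1 j1 v1 u2 i2 j2 v2 :
    u1 ++ [:: i1, j1 & v1] = u2 ++ [:: i2, j2 & v2] ->
    (size u1 <= size u2)%N ->
  [\/ [/\ u2 = u1, i2 = i1, j2 = j1 & v2 = v1],
      [/\ u2 = rcons u1 i1, i2 = j1 & v1 = j2 :: v2] |
      exists2 t, u2 = u1 ++ [:: i1, j1 & t] & v1 = t ++ [:: i2, j2 & v2] ].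
Proof.
elim: u1 u2 => [|a u1 IHu] [|b u2] //=.
- by case=> <- <- <- _; constructor 1.
- case: u2 => [|b' u2] /=.
    by case=> -> -> -> _; constructor 2.
  by case=> -> -> -> _; constructor 3; exists u2.
- case=> -> E; rewrite ltnS => /(IHu _ E)[[-> -> -> ->]|[-> -> ->]|[t -> ->]].
  + by constructor 1.
  + by constructor 2.
  + by constructor 3; exists t.
Qed.

Lemma sum_insert_swap phi u1 f u2 g v :
  \sum_k f k * insert_vec phi (u1 ++ k :: u2) g v =
  \sum_k g k * insert_vec phi u1 f (u2 ++ k :: v).
Proof.
rewrite /insert_vec; under eq_bigr do rewrite mulr_sumr.
rewrite exchange_big /=; apply: eq_bigr => k _.
rewrite mulr_sumr; apply: eq_bigr => l _.
by rewrite mulrCA -catA.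
Qed.

(** In U(L) this reads f x_j = x_j f + [f, x_j] for a vector f, by linearity from the letters. *)
Lemma insert_vec_rel phi u f j v :
    (forall k, bracket_rel_at phi u k j v) ->
  insert_vec phi u f (j :: v) =
  insert_vec phi (rcons u j) f v
  + insert_vec phi u (fun m => \sum_l f l * c l j m) v.
Proof.
move=> rel_phi; rewrite /insert_vec.
under eq_bigr do rewrite rel_phi mulrDr.
rewrite big_split /=; congr (_ + _).
  by apply: eq_bigr => k _; rewrite cat_rcons.
under [RHS]eq_bigr do rewrite mulr_suml.
rewrite exchange_big /=; apply: eq_bigr => k _.
by rewrite mulr_sumr; apply: eq_bigr => l _; rewrite mulrA.
Qed.

Definition resolve phi u i j v :=
  phi (u ++ [:: j, i & v]) + insert_vec phi u (c i j) v.

(* Disjoint descents commute; the overlap a > b > d is the Jacobi identity.   *)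
Lemma pbw_confluence phi u1 i1 j1 v1 u2 i2 j2 v2 :
    (forall u i j v, (size (u ++ [:: i, j & v]) < size (u1 ++ [:: i1, j1 & v1]))%N ->
      bracket_rel_at phi u i j v) ->
    (forall u i j v, size (u ++ [:: i, j & v]) = size (u1 ++ [:: i1, j1 & v1]) ->
      (j < i)%N ->
      (inversions (u ++ [:: i, j & v]) < inversions (u1 ++ [:: i1, j1 & v1]))%N ->
      bracket_rel_at phi u i j v) ->
    u1 ++ [:: i1, j1 & v1] = u2 ++ [:: i2, j2 & v2] ->
    (j1 < i1)%N -> (j2 < i2)%N ->
  resolve phi u1 i1 j1 v1 = resolve phi u2 i2 j2 v2.
Proof.
move=> IHsz IHinv Ew lt1 lt2.
wlog le12 : u1 i1 j1 v1 u2 i2 j2 v2 Ew IHsz IHinv lt1 lt2 / (size u1 <= size u2)%N.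
  move=> IH; case: (leqP (size u1) (size u2)) => [|/ltnW] le; first exact: IH.
  by apply/esym/IH => //; rewrite -Ew.
have [[-> -> -> ->] //|[E2 Ei E1]|[t E2 E1]] := two_descents Ew le12.
- move: IHsz IHinv lt2; rewrite {}E2 {}E1 {}Ei {le12 Ew u2 v1 i2}.
  move: u1 i1 j1 j2 v2 lt1 => u a b d v ltba IHsz IHinv ltdb.
  have ltda := ltn_trans ltdb ltba.
  have inv1 := inversions_swap u (d :: v) ltba.
  have inv2 := inversions_swap (rcons u a) v ltdb.
  have inv3 := inversions_swap (rcons u b) v ltda.
  have inv4 := inversions_swap u (b :: v) ltda.
  rewrite !cat_rcons in inv2 inv3 inv4.
  have szr e w : size (rcons u e ++ w) = (size u + size w).+1.
    by rewrite size_cat size_rcons addSn.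
  have IHk e k : bracket_rel_at phi u k e v.
    by apply: IHsz; rewrite !size_cat /= !addnS.
  have E1 : bracket_rel_at phi (rcons u b) a d v.
    by apply: IHinv => //; rewrite ?szr ?size_cat /= ?addnS // cat_rcons inv1.
  have E2 : bracket_rel_at phi u b d (a :: v).
    apply: IHinv => //; rewrite ?szr ?size_cat /= ?addnS //.
    by rewrite inv1 inv3 ltnS ltnW.
  have E3 : bracket_rel_at phi u a d (b :: v).
    by apply: IHinv => //; rewrite ?szr ?size_cat /= ?addnS // inv2.
  have E4 : bracket_rel_at phi (rcons u d) a b v.
    apply: IHinv => //; rewrite ?szr ?size_cat /= ?addnS // cat_rcons.
    by rewrite inv2 inv4 ltnS ltnW.
  rewrite /bracket_rel_at !cat_rcons in E1 E2 E3 E4.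
  rewrite /resolve !cat_rcons E1 E2 E3 E4.
  rewrite (insert_vec_rel _ (IHk d)) (insert_vec_rel _ (IHk a)).
  rewrite (insert_vec_rel _ (IHk b)).
  have -> : insert_vec phi u (fun m => \sum_l c a d l * c l b m) v =
      insert_vec phi u (fun m => \sum_l c b d l * c l a m) v
      + insert_vec phi u (fun m => \sum_l c a b l * c l d m) v.
    rewrite -big_split /=; apply: eq_bigr => m _; rewrite -mulrDl; congr (_ * _).
    have := c_jacobi a b d m; rewrite !big_split /=.
    under [X in _ + X + _]eq_bigr do rewrite c_anti mulNr.
    rewrite sumrN => J; apply/eqP; rewrite -subr_eq0 -oppr_eq0; apply/eqP.
    by rewrite -[RHS]J; ring.
  by ring.
- move: IHsz IHinv; rewrite {}E2 {}E1 {le12 Ew u2 v1} => IHsz IHinv.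
  have inv1 := inversions_swap u1 (t ++ [:: i2, j2 & v2]) lt1.
  have inv2 := inversions_swap (u1 ++ [:: i1, j1 & t]) v2 lt2.
  rewrite -!catA /= in inv2.
  have IHl k : bracket_rel_at phi (u1 ++ k :: t) i2 j2 v2.
    by apply: IHsz; rewrite -catA !size_cat /= size_cat /= !addnS.
  have IHr k : bracket_rel_at phi u1 i1 j1 (t ++ k :: v2).
    by apply: IHsz; rewrite !size_cat /= !size_cat /= !addnS.
  have E1 : bracket_rel_at phi (u1 ++ [:: j1, i1 & t]) i2 j2 v2.
    by apply: IHinv; rewrite -?catA /= ?inv1 // !size_cat /= !size_cat.
  have E2 : bracket_rel_at phi u1 i1 j1 (t ++ [:: j2, i2 & v2]).
    by apply: IHinv; rewrite ?inv2 // !size_cat /= !size_cat.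
  rewrite /bracket_rel_at -!catA /= in E1 E2.
  rewrite /resolve -!catA /= E1 E2 -!addrA; congr (_ + _).
  have -> : insert_vec phi u1 (c i1 j1) (t ++ [:: i2, j2 & v2]) =
      insert_vec phi u1 (c i1 j1) (t ++ [:: j2, i2 & v2])
      + \sum_k c i1 j1 k * insert_vec phi (u1 ++ k :: t) (c i2 j2) v2.
    rewrite -big_split /=; apply: eq_bigr => k _.
    by have := IHl k; rewrite /bracket_rel_at -!catA /= => ->; rewrite mulrDr.
  rewrite addrCA; congr (_ + _); rewrite sum_insert_swap.
  rewrite /insert_vec -big_split /=; apply: eq_bigr => k _.
  by have := IHr k; rewrite /bracket_rel_at -!catA /= => ->; rewrite mulrDr.
Qed.

(** The independence half of PBW. By induction on length and then on inversions: the relation is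
    built in at the descent that [descent] picks, and confluence carries it to any other. *)
Theorem pbw_extension_rel psi : bracket_rel (pbw_extension psi).
Proof.
move=> u i j v; have [s] := ubnP (size (u ++ [:: i, j & v])).
elim: s u i j v => // s IHs u i j v; rewrite ltnS leq_eqVlt.
case/predU1P => [sz_uv|]; last exact: IHs.
wlog ltji : i j sz_uv / (j < i)%N => [IH|].
  case: (ltngtP j i) => [|ltij|/val_inj ->]; first exact: IH.
    by apply/bracket_rel_sym/IH; rewrite // -sz_uv !size_cat.
  exact: bracket_rel_refl.
have [m] := ubnP (inversions (u ++ [:: i, j & v])).
elim: m u i j v sz_uv ltji => // m IHm u i j v sz_uv ltji inv_m.
case Dw: (descent (u ++ [:: i, j & v])) => [[[[u' i'] j'] v']|]; last first.
  by move/descent_sorted/sorted_no_descent: Dw; rewrite ltji.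
have [Ew ltj'] := descentP Dw.
rewrite /bracket_rel_at {1}Ew (pbw_extension_descent _ Dw).
apply: (@pbw_confluence _ u' i' j' v' u i j v) => // [u1 i1 j1 v1|u1 i1 j1 v1].
  by rewrite -Ew sz_uv; apply: IHs.
rewrite -Ew => Es lt1 lt_m; apply: IHm; rewrite ?Es //.
exact: leq_trans lt_m _.
Qed.

(** The spanning half of PBW: resolving a descent leaves a word with fewer inversions and shorter
    words. *)
Lemma bracket_rel_eq0 phi : bracket_rel phi ->
  (forall w, sorted letter_le w -> phi w = 0) -> forall w, phi w = 0.
Proof.
move=> rel_phi phi0 w; have [s] := ubnP (size w).
elim: s w => // s IHs w; have [m] := ubnP (inversions w).
elim: m w => // m IHm w inv_m sz_w.
case Dw: (descent w) => [[[[u i] j] v]|]; last exact/phi0/descent_sorted.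
have [Ew ltji] := descentP Dw.
rewrite Ew rel_phi /insert_vec IHm ?add0r ?big1 // => [k _||].
- by rewrite IHs ?mulr0 //; move: sz_w; rewrite Ew !size_cat /= !addnS.
- by move: inv_m; rewrite Ew inversions_swap.
- by move: sz_w; rewrite Ew !size_cat.
Qed.
End Bracket.
End Words.

(** * p-polynomials *)

Section PPolynomial.
Variables (F : fieldType) (p : nat).
Hypothesis pcharFp : p \in [pchar F].

Let p_pr : prime p := pcharf_prime pcharFp.

Lemma exprD_pchar_pow (R : comNzRingType) s (x y : R) :
  p \in [pchar R] -> (x + y) ^+ (p ^ s) = x ^+ (p ^ s) + y ^+ (p ^ s).
Proof.
move=> pcharR; apply: exprDn_pchar; rewrite (eq_pnat _ (pcharf_eq pcharR)).
by rewrite pnatX pnat_id ?(pcharf_prime pcharR).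
Qed.

(** Compare the coefficients of X^s in (X + 1)^(p^t) = X^(p^t) + 1. *)
Lemma bin_pow_pchar t s : (0 < s < p ^ t)%N -> ('C(p ^ t, s))%:R = 0 :> F.
Proof.
case/andP=> s_gt0 s_lt.
have pcharP : p \in [pchar {poly F}] by rewrite pchar_poly.
have := congr1 (fun P : {poly F} => P`_s) (exprD_pchar_pow t 'X 1 pcharP).
rewrite /= exprD1n coef_sum coefD expr1n coef1 coefXn (ltn_eqF s_lt).
rewrite eqn0Ngt s_gt0 /= mulr0n addr0 => <-.
have s_ltS : (s < (p ^ t).+1)%N by apply: ltnW.
rewrite (bigD1 (Ordinal s_ltS)) //= coefMn coefXn eqxx big1 ?addr0 // => i ne_is.
by rewrite coefMn coefXn eq_sym (negPf ne_is : (i == s :> nat) = false) mul0rn.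
Qed.

(** The n + 1 remainders of X^(p^j) modulo [chi] have degree at most n and, 0 being a root of [chi],
    no constant term. They lie in a space of dimension n. *)
Lemma ppoly_dependent n (chi : {poly F}) :
    size chi = n.+2 -> root chi 0 ->
  exists2 v : 'rV[F]_n.+1, v != 0 & chi %| \sum_(j < n.+1) v 0 j *: 'X^(p ^ j).
Proof.
move=> sz_chi chi0.
have rem0 j : ('X^(p ^ j) %% chi)`_0 = 0.
  by rewrite -horner_coef0 horner_mod // hornerXn expr0n expn_eq0 eqn0Ngt prime_gt0.
pose M := \matrix_(i < n.+1, j < n) ('X^(p ^ i) %% chi)`_j.+1.
have : kermx M != 0.
  rewrite -mxrank_eq0 mxrank_ker subn_eq0 -ltnNge ltnS; exact: rank_leq_col.
case/rowV0Pn=> v /sub_kermxP vM0 v_neq0; exists v => //.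
rewrite /dvdp; apply/eqP; apply/polyP=> k; rewrite coef0.
have -> : (\sum_(j < n.+1) v 0 j *: 'X^(p ^ j)) %% chi =
    \sum_(j < n.+1) v 0 j *: ('X^(p ^ j) %% chi).
  rewrite (big_morph (fun P : {poly F} => P %% chi) (modpD chi) (mod0p chi)).
  by apply: eq_bigr => j _; rewrite modpZl.
rewrite coef_sum; under eq_bigr do rewrite coefZ.
case: k => [|k]; first by rewrite big1 // => j _; rewrite rem0 mulr0.
have [lt_kn|le_nk] := ltnP k n.
  have := congr1 (fun A : 'rV_n => A 0 (Ordinal lt_kn)) vM0.
  by rewrite !mxE => E; rewrite -[RHS]E; apply: eq_bigr => j _; rewrite mxE.
rewrite big1 // => j _; rewrite nth_default ?mulr0 // -ltnS.
apply: leq_trans (_ : (n.+2 <= _)%N); last by rewrite !ltnS.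
by rewrite -sz_chi ltn_modp -size_poly_eq0 sz_chi.
Qed.

(** The dependency may stop at an index m < n. Divided by its leading coefficient and raised to the
    power p^(n-m), which is additive in characteristic p, it stays a p-polynomial divisible by
    [chi], and its top index becomes n. *)
Lemma ppoly_multiple n (chi : {poly F}) :
    size chi = n.+2 -> root chi 0 ->
  exists2 l : nat -> F, l n = 1 & chi %| \sum_(j < n.+1) l j *: 'X^(p ^ j).
Proof.
move=> sz_chi chi0; have [v v_neq0 dv_chi] := ppoly_dependent sz_chi chi0.
have [j0 v_j0] : exists j0, v 0 j0 != 0.
  by apply/rV0Pn.
case: (arg_maxnP (P := fun j => v 0 j != 0) (fun j : 'I_n.+1 => j : nat) v_j0).
move=> m v_m max_m {j0 v_j0}; have le_mn : (m <= n)%N := ltn_ord m; set s := (n - m)%N.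
pose w (j : nat) := v 0 (inord j) / v 0 m.
exists (fun j => if (s <= j)%N then w (j - s)%N ^+ (p ^ s) else 0).
  by rewrite leq_subr subKn // /w inord_val divff // expr1n.
have pcharP : p \in [pchar {poly F}] by rewrite pchar_poly.
have : chi %| (\sum_(j < m.+1) w j *: 'X^(p ^ j)) ^+ (p ^ s).
  apply: dvdp_exp; first by rewrite expn_gt0 prime_gt0.
  have -> : \sum_(j < m.+1) w j *: 'X^(p ^ j) =
     (v 0 m)^-1 *: \sum_(j < n.+1) v 0 j *: 'X^(p ^ j).
    rewrite (big_ord_widen _ (fun j : nat => w j *: 'X^(p ^ j)) (ltn_ord m)).
    rewrite scaler_sumr big_mkcond; apply: eq_bigr => j _; case: ltnP => [_|ltmj].
      by rewrite scalerA /w inord_val mulrC.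
    have [->|/max_m] := eqVneq (v 0 j) 0; first by rewrite scale0r scaler0.
    by rewrite /= /geq /= leqNgt ltmj.
  by rewrite dvdpZr // invr_eq0.
suff -> : (\sum_(j < m.+1) w j *: 'X^(p ^ j)) ^+ (p ^ s) =
  \sum_(j < n.+1) (if (s <= j)%N then w (j - s)%N ^+ (p ^ s) else 0) *: 'X^(p ^ j).
  by [].
rewrite (big_morph (fun x : {poly F} => x ^+ (p ^ s)) (id1 := 0) (op1 := +%R)) /=;
  last 2 first.
- by move=> x y; apply: exprD_pchar_pow.
- by rewrite expr0n expn_eq0 eqn0Ngt prime_gt0.
rewrite -(big_mkord xpredT (fun j => (w j *: 'X^(p ^ j)) ^+ (p ^ s))).
rewrite -(big_mkord xpredT (fun j =>
  (if (s <= j)%N then w (j - s)%N ^+ (p ^ s) else 0) *: 'X^(p ^ j))).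
rewrite [RHS](big_cat_nat (n := s)) //=; last by rewrite leqW // leq_subr.
rewrite [X in _ = X + _]big_nat [X in _ = X + _]big1 ?add0r; last first.
  by move=> j /= ltjs; rewrite leqNgt ltjs scale0r.
rewrite -{2}[s]add0n big_addn subSn ?leq_subr // subKn //.
apply: eq_bigr => j _; rewrite leq_addl addnK exprZn -exprM -expnD.
by [].
Qed.
End PPolynomial.

(** * Words in a basis of a Lie algebra *)

Section LieBasics.
Variables (F : fieldType) (L : lieAlgType F).
Implicit Types x y z : L.

Lemma lieDl x y z : lie (x + y) z = lie x z + lie y z.
Proof. by have := lie_linearl z 1 x y; rewrite !scale1r. Qed.

Lemma lieDr x y z : lie z (x + y) = lie z x + lie z y.
Proof. by have := lie_linearr z 1 x y; rewrite !scale1r. Qed.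

Lemma lie0l z : lie 0 z = 0.
Proof. by apply: (@addIr _ (lie 0 z)); rewrite -lieDl !add0r. Qed.

Lemma lie0r z : lie z 0 = 0.
Proof. by apply: (@addIr _ (lie z 0)); rewrite -lieDr !add0r. Qed.

Lemma lieZl a x z : lie (a *: x) z = a *: lie x z.
Proof. by have := lie_linearl z a x 0; rewrite !addr0 lie0l addr0. Qed.

Lemma lieZr a x z : lie z (a *: x) = a *: lie z x.
Proof. by have := lie_linearr z a x 0; rewrite !addr0 lie0r addr0. Qed.

Lemma lie_suml (I : Type) (r : seq I) (P : pred I) (f : I -> L) z :
  lie (\sum_(i <- r | P i) f i) z = \sum_(i <- r | P i) lie (f i) z.
Proof. exact: (big_morph (lie^~ z) (fun x y => lieDl x y z) (lie0l z)). Qed.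

Lemma lie_sumr (I : Type) (r : seq I) (P : pred I) (f : I -> L) z :
  lie z (\sum_(i <- r | P i) f i) = \sum_(i <- r | P i) lie z (f i).
Proof. exact: (big_morph (lie z) (fun x y => lieDr x y z) (lie0r z)). Qed.

Lemma lie_antisym x y : lie x y = - lie y x.
Proof.
apply/eqP; rewrite -subr_eq0 opprK; apply/eqP.
by have := liexx (x + y); rewrite lieDl !lieDr !liexx add0r addr0.
Qed.
End LieBasics.

(** Pascal's rule under the sum, for the induction step of [insert_lie_leibniz]. *)
Lemma pascal_sum (R : nzRingType) t (g : nat -> R) :
  \sum_(s < t.+1) 'C(t, s)%:R * (g s + g s.+1) =
  \sum_(s < t.+2) 'C(t.+1, s)%:R * g s.
Proof.
under eq_bigr do rewrite mulrDr.
rewrite big_split /= [RHS]big_ord_recl /=.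
under [X in _ = _ + X]eq_bigr do rewrite /bump /= add1n binS natrD mulrDl.
rewrite big_split /= addrA; congr (_ + _).
rewrite [X in _ = _ + X]big_ord_recr /= (bin_small (ltnSn t)) mul0r addr0.
by rewrite big_ord_recl /= !bin0.
Qed.

Section LieBasis.
Variables (F : fieldType) (p : nat) (L : finLieAlgType F) (n : nat).
Hypothesis pcharFp : p \in [pchar F].
Variable X : n.-tuple L.
Hypothesis basisX : basis_of fullv X.
Implicit Types (i j k : 'I_n) (x y : L) (phi : seq 'I_n -> F).

Lemma basis_coord x : x = \sum_i coord X i x *: X`_i.
Proof. exact: (coord_basis basisX (memvf x)). Qed.

Lemma coord_basis_delta i k : coord X k X`_i = (k == i)%:R.
Proof. by rewrite coord_free ?(basis_free basisX) // eq_sym. Qed.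

Definition structure_const i j k : F := coord X k (lie X`_i X`_j).

Lemma structure_const_alt i k : structure_const i i k = 0.
Proof. by rewrite /structure_const liexx linear0. Qed.

Lemma structure_const_anti i j k : structure_const i j k = - structure_const j i k.
Proof. by rewrite /structure_const lie_antisym linearN. Qed.

Lemma coord_lie_basis x j k :
  coord X k (lie x X`_j) = \sum_l coord X l x * structure_const l j k.
Proof.
rewrite {1}(basis_coord x) lie_suml linear_sum; apply: eq_bigr => l _.
by rewrite lieZl linearZ.
Qed.

Lemma structure_const_jacobi a b d m :
  \sum_l (structure_const b d l * structure_const l a m
    + structure_const d a l * structure_const l b m
    + structure_const a b l * structure_const l d m) = 0.
Proof.
rewrite !big_split /= -!coord_lie_basis -!linearD /=.
rewrite !(lie_antisym (lie _ _)) -!opprD.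
by rewrite addrAC addrAC lie_jacobi oppr0 linear0.
Qed.

Definition insert_lie phi u x v := insert_vec phi u (fun k => coord X k x) v.

Lemma insert_lie_basis phi u i v : insert_lie phi u X`_i v = phi (u ++ i :: v).
Proof.
rewrite /insert_lie /insert_vec (bigD1 i) //= coord_basis_delta eqxx mul1r.
rewrite big1 ?addr0 // => k ne_ki.
by rewrite coord_basis_delta (negPf ne_ki) mul0r.
Qed.

Lemma insert_lieD phi u x y v :
  insert_lie phi u (x + y) v = insert_lie phi u x v + insert_lie phi u y v.
Proof.
rewrite /insert_lie /insert_vec -big_split; apply: eq_bigr => k _.
by rewrite linearD mulrDl.
Qed.

Lemma insert_lieZ phi u a x v :
  insert_lie phi u (a *: x) v = a * insert_lie phi u x v.
Proof.
rewrite /insert_lie /insert_vec mulr_sumr; apply: eq_bigr => k _.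
by rewrite linearZ mulrA.
Qed.

Lemma insert_lie0 phi u v : insert_lie phi u 0 v = 0.
Proof. by rewrite -(scale0r 0) insert_lieZ mul0r. Qed.

Lemma insert_lie_sum (I : Type) (r : seq I) (P : pred I) (f : I -> L) phi u v :
  insert_lie phi u (\sum_(i <- r | P i) f i) v =
  \sum_(i <- r | P i) insert_lie phi u (f i) v.
Proof.
exact: (big_morph (fun y => insert_lie phi u y v)
  (fun x y => insert_lieD phi u x y v) (insert_lie0 phi u v)).
Qed.

Section Relation.
Variable phi : seq 'I_n -> F.
Hypothesis rel_phi : bracket_rel structure_const phi.

Lemma insert_lie_swap u i x v :
  insert_lie phi (rcons u i) x v =
  insert_lie phi u x (i :: v) + insert_lie phi u (lie X`_i x) v.
Proof.
rewrite {2}/insert_lie (insert_vec_rel (c := structure_const)); last first.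
  by move=> k; apply: rel_phi.
rewrite -addrA -[LHS]addr0; congr (_ + _).
have -> : insert_vec phi u
    (fun m => \sum_l coord X l x * structure_const l i m) v =
  insert_lie phi u (lie x X`_i) v.
  by apply: eq_bigr => k _; rewrite coord_lie_basis.
by rewrite -insert_lieD (lie_antisym x) addNr insert_lie0.
Qed.

(** Left multiplication by x_i in U(L) is the sum of two commuting maps, right multiplication by x_i
    and ad x_i; this is the binomial expansion of its t-th power. *)
Lemma insert_lie_leibniz u i x v t :
  insert_lie phi (u ++ nseq t i) x v =
  \sum_(s < t.+1) 'C(t, s)%:R *
    insert_lie phi u (iter s (lie X`_i) x) (nseq (t - s) i ++ v).
Proof.
elim: t u => [|t IHt] u.
  by rewrite big_ord1 cats0 bin0 mul1r.
rewrite /= -cat_rcons IHt.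
pose g s := insert_lie phi u (iter s (lie X`_i) x) (nseq (t.+1 - s) i ++ v).
rewrite -(pascal_sum t g); apply: eq_bigr => s _.
by rewrite insert_lie_swap /g subSS subSn // -ltnS.
Qed.

(** Only the two extreme binomial coefficients survive: (ad x_i)^(p^t) is the commutator with
    x_i^(p^t). *)
Lemma insert_lie_pow u i x v t :
  insert_lie phi (u ++ nseq (p ^ t) i) x v =
  insert_lie phi u x (nseq (p ^ t) i ++ v)
  + insert_lie phi u (iter (p ^ t) (lie X`_i) x) v.
Proof.
have := bin_pow_pchar pcharFp (t := t).
have : (0 < p ^ t)%N by rewrite expn_gt0 prime_gt0 // (pcharf_prime pcharFp).
case: (p ^ t)%N => // q _ bin_q.
rewrite insert_lie_leibniz big_ord_recl big_ord_recr big1 => [|s _]; last first.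
  by rewrite bin_q ?mul0r //= /bump /= add1n ltnS.
by rewrite /= add0r bin0 mul1r /bump /= add1n binn mul1r subnn.
Qed.

End Relation.

(** Row convention: [ad x] multiplies coordinate rows on the right. *)
Definition ad_matrix x : 'M[F]_n := \matrix_(i, j) coord X j (lie x X`_i).

Definition coord_row y : 'rV[F]_n := \row_j coord X j y.

Lemma coord_row_inj y : coord_row y = 0 -> y = 0.
Proof.
move=> y0; rewrite (basis_coord y) big1 // => i _.
by have := congr1 (fun A : 'rV_n => A 0 i) y0; rewrite !mxE => ->; rewrite scale0r.
Qed.

Lemma coord_row_lie x y : coord_row (lie x y) = coord_row y *m ad_matrix x.
Proof.
apply/rowP=> j; rewrite !mxE {1}(basis_coord y) lie_sumr linear_sum.
by apply: eq_bigr => i _; rewrite lieZr linearZ !mxE.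
Qed.

End LieBasis.

(** For nonzero x, [x, x] = 0 makes ad x singular, so [ppoly_multiple] applies to its characteristic
    polynomial, and Cayley-Hamilton concludes. *)
Lemma ad_ppoly (F : fieldType) p (L : finLieAlgType F) n (x : L) :
    p \in [pchar F] -> \dim {:L} = n.+1 ->
  exists2 l : nat -> F, l n = 1 &
    forall y, \sum_(j < n.+1) l j *: iter (p ^ j) (lie x) y = 0.
Proof.
move=> pcharFp dimL; have [->|x_neq0] := eqVneq x 0.
  (* For x = 0, X^(p^n) serves: each p^j is positive, so every iterate of ad 0 that occurs is 0. *)
  exists (fun j => (j == n)%:R) => [|y]; first by rewrite eqxx.
  rewrite big1 // => j _; have : (0 < p ^ j)%N.
    by rewrite expn_gt0 prime_gt0 // (pcharf_prime pcharFp).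
  by case: (p ^ j)%N => //= q _; rewrite lie0l scaler0.
pose X := tcast dimL (vbasis {:L}).
have basisX : basis_of fullv X by rewrite val_tcast; apply: vbasisP.
pose A := ad_matrix X x.
have chi0 : root (char_poly A) 0.
  rewrite rootE horner_coef0 char_poly_det mulf_eq0 expf_eq0 oppr_eq0 oner_eq0 andbF.
  apply/det0P; exists (coord_row X x); last first.
    by rewrite -coord_row_lie // liexx; apply/rowP=> j; rewrite !mxE linear0.
  by apply/eqP=> /(coord_row_inj basisX) x0; rewrite x0 eqxx in x_neq0.
have [l ln1 dvd_l] := ppoly_multiple pcharFp (size_char_poly A) chi0.
exists l => // y; apply: (coord_row_inj basisX).
have iterA t : coord_row X (iter t (lie x) y) = coord_row X y *m A ^+ t.
  elim: t => [|t IHt]; first by rewrite expr0 mulmx1.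
  by rewrite iterS coord_row_lie // IHt -mulmxA exprSr.
have -> : coord_row X (\sum_(j < n.+1) l j *: iter (p ^ j) (lie x) y) =
   coord_row X y *m horner_mx A (\sum_(j < n.+1) l j *: 'X^(p ^ j)).
  rewrite raddf_sum mulmx_sumr; apply/rowP=> k; rewrite !mxE linear_sum summxE.
  apply: eq_bigr => j _; rewrite linearZ /=.
  have := congr1 (fun B : 'rV_n.+1 => B 0 k) (iterA (p ^ j)%N); rewrite /= mxE => ->.
  by rewrite linearZ /= rmorphXn /= horner_mx_X -scalemxAr !mxE.
have /dvdpP [Q ->] := dvd_l.
by rewrite rmorphM /= Cayley_Hamilton mulr0 mulmx0.
Qed.

(** * Centrality of p-polynomials in U(L) *)

Section Central.
Variables (F : fieldType) (p : nat) (L : finLieAlgType F) (n : nat).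
Hypothesis pcharFp : p \in [pchar F].
Variables (X : n.+1.-tuple L) (l : 'I_n.+1 -> nat -> F).
Hypothesis basisX : basis_of fullv X.
Hypothesis ad_l :
  forall i y, \sum_(j < n.+1) l i j *: iter (p ^ j) (lie X`_i) y = 0.

Definition insert_ppoly (phi : seq 'I_n.+1 -> F) i u v :=
  \sum_(j < n.+1) l i j * phi (u ++ nseq (p ^ j) i ++ v).

(** The commutator of P_i(x_i) with x_k is P_i(ad x_i)(x_k), which is 0 by [ad_l]. *)
Lemma insert_ppoly_central phi i u k v : bracket_rel (structure_const X) phi ->
  insert_ppoly phi i u (k :: v) = insert_ppoly phi i (rcons u k) v.
Proof.
move=> rel_phi; pose D j := iter (p ^ j) (lie X`_i) X`_k.
have E j : phi (u ++ nseq (p ^ j) i ++ k :: v) =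
    phi (rcons u k ++ nseq (p ^ j) i ++ v) + insert_lie X phi u (D j) v.
  have := insert_lie_pow pcharFp basisX rel_phi u i X`_k v j.
  by rewrite !insert_lie_basis // -catA cat_rcons.
rewrite /insert_ppoly; under eq_bigr do rewrite E mulrDr.
rewrite big_split /= -[RHS]addr0; congr (_ + _).
under eq_bigr do rewrite -insert_lieZ.
by rewrite -insert_lie_sum ad_l insert_lie0.
Qed.

Lemma insert_ppoly_cat phi i u v w : bracket_rel (structure_const X) phi ->
  insert_ppoly phi i u (v ++ w) = insert_ppoly phi i (u ++ v) w.
Proof.
move=> rel_phi; elim: v u => [|k v IHv] u; first by rewrite cats0.
by rewrite /= insert_ppoly_central // IHv cat_rcons.
Qed.

End Central.

(** * Reduced extensions of functions on sorted words *)

Section SortedWords.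
Variable n : nat.
Implicit Types (i : 'I_n) (u v w : seq 'I_n).

Definition word_lt w i := [seq k : 'I_n <- w | (k < i)%N].
Definition word_gt w i := [seq k : 'I_n <- w | (i < k)%N].

Lemma sorted_word_eq w1 w2 :
  sorted (@letter_le n) w1 -> sorted (@letter_le n) w2 -> perm_eq w1 w2 -> w1 = w2.
Proof.
apply: sorted_eq; first exact: letter_le_trans.
by move=> i j; rewrite /letter_le => /anti_leq /val_inj.
Qed.

Lemma sorted_insert i w t : sorted (@letter_le n) w ->
  sorted (@letter_le n) (word_lt w i ++ nseq t i ++ word_gt w i).
Proof.
have tr := @letter_le_trans n.
rewrite !(sorted_pairwise tr) => w_s; rewrite !pairwise_cat.
rewrite !(pairwise_filter _ w_s) /word_lt /word_gt.
have -> : pairwise (@letter_le n) (nseq t i).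
  elim: t => //= t ->; rewrite andbT; apply/allP=> k /nseqP[-> _].
  exact: leqnn.
rewrite !andbT /=; apply/andP; split; apply/allrelP=> a b.
- rewrite mem_filter mem_cat => /andP[lt_ai _] /orP[/nseqP[-> _]|].
    exact: ltnW.
  rewrite mem_filter => /andP[lt_ib _]; apply: ltnW; exact: ltn_trans lt_ib.
- by move=> /nseqP[-> _]; rewrite mem_filter => /andP[/ltnW].
Qed.

Lemma perm_insert i w :
  perm_eq (word_lt w i ++ nseq (count_mem i w) i ++ word_gt w i) w.
Proof.
apply/permP=> a; rewrite !count_cat count_nseq /word_lt /word_gt.
elim: w => [|k w IHw] /=; first by rewrite muln0.
rewrite -IHw -val_eqE /=; case: (ltngtP k i) => [lt|lt|/val_inj ->] /=.
- by rewrite add0n !addnA.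
- by rewrite add0n [(a i * _ + (_ + _))%N]addnCA [RHS]addnCA.
- by rewrite add1n mulnS -addnA addnCA.
Qed.

(** Isolates the block of the letter [i], whose length can then be changed with the word still
    sorted. *)
Lemma sorted_wordE w i : sorted (@letter_le n) w ->
  w = word_lt w i ++ nseq (count_mem i w) i ++ word_gt w i.
Proof.
move=> w_s; apply: sorted_word_eq => //; first exact: sorted_insert.
by rewrite perm_sym; apply: perm_insert.
Qed.

End SortedWords.

(** * The linear recurrence in one exponent *)

Section Modulus.
Variables (F : fieldType) (p n : nat) (l : nat -> F).
Hypotheses (p_gt1 : (1 < p)%N) (l_n : l n = 1).

Definition modulus : {poly F} := \sum_(j < n.+1) l j *: 'X^(p ^ j) - 1.

Lemma size_modulus : size modulus = (p ^ n).+1.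
Proof.
have q_gt0 : (0 < p ^ n)%N by rewrite expn_gt0 ltnW.
rewrite /modulus big_ord_recr /= l_n scale1r addrAC addrC size_polyDl ?size_polyXn //.
rewrite ltnS; apply: leq_trans (size_polyD _ _) _.
rewrite geq_max size_polyN size_poly1 q_gt0 andbT.
apply: leq_trans (size_sum _ _ _) _; apply/bigmax_leqP=> j _.
apply: leq_trans (size_scale_leq _ _) _.
by rewrite size_polyXn ltn_exp2l.
Qed.

(* As a function of t, the solution of the recurrence [weight_rec] with value  *)
(* 1 at r and 0 at the other t < p^n.                                         *)
Definition weight (r t : nat) : F := ('X^t %% modulus)`_r.

(** As [modulus] is P - 1, the polynomials X^t P and X^t have the same remainder. *)
Lemma weight_rec r t :
  \sum_(j < n.+1) l j * weight r (t + p ^ j) = weight r t.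
Proof.
have -> : \sum_(j < n.+1) l j * weight r (t + p ^ j) =
    (('X^t * (modulus + 1)) %% modulus)`_r.
  rewrite subrK mulr_sumr (big_morph (fun P => P %% modulus) (modpD _) (mod0p _)).
  rewrite coef_sum; apply: eq_bigr => j _.
  by rewrite -scalerAr modpZl coefZ -exprD.
by rewrite mulrDr mulr1 modpD modp_mull add0r.
Qed.

Lemma weight_small r t : (t < p ^ n)%N -> weight r t = (r == t)%:R.
Proof.
by move=> lt_t; rewrite /weight modp_small ?coefXn // size_polyXn size_modulus ltnS.
Qed.
End Modulus.

Lemma lie_lfunE (F : fieldType) (V : vectType F) (f g : 'End(V)) v :
  lie f g v = f (g v) - g (f v).
Proof. by rewrite [lie f g]/(commutator_lfun f g) !lfun_simp. Qed.

(** * The reduced module *)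

Section Reduced.
Variables (F : fieldType) (p : nat) (L : finLieAlgType F) (n : nat).
Hypothesis pcharFp : p \in [pchar F].
Variables (X : n.+1.-tuple L) (l : 'I_n.+1 -> nat -> F).
Hypothesis basisX : basis_of fullv X.
Hypothesis ad_l :
  forall i y, \sum_(j < n.+1) l i j *: iter (p ^ j) (lie X`_i) y = 0.
Hypothesis l_n : forall i, l i n = 1.

Notation word := (seq 'I_n.+1).
Notation expo := {ffun 'I_n.+1 -> 'I_(p ^ n)}.
Notation bracket := (bracket_rel (structure_const X)).
Implicit Types (i : 'I_n.+1) (w : word) (phi : word -> F) (r : expo).
Implicit Types (g : {ffun expo -> F^o}).

Let p_gt1 : (1 < p)%N := prime_gt1 (pcharf_prime pcharFp).

(** Insertion at the front is enough: for functionals satisfying the bracket relation, centrality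
    moves P_i(x_i) anywhere. *)
Definition ppoly_rel phi := forall i w, insert_ppoly p l phi i [::] w = phi w.

Definition normal_word r : word :=
  sort (@letter_le _) (flatten [seq nseq (r i) i | i <- enum 'I_n.+1]).

Lemma normal_word_sorted r : sorted (@letter_le _) (normal_word r).
Proof. by apply: sort_sorted => i j; apply: leq_total. Qed.

Lemma count_normal_word r i : count_mem i (normal_word r) = r i.
Proof.
rewrite /normal_word; have /permPl/permP-> := perm_sort (@letter_le n.+1)
  (flatten [seq nseq (r i) i | i <- enum 'I_n.+1]).
rewrite count_flatten -map_comp sumnE big_map big_enum /= (bigD1 i) //=.
rewrite count_nseq /= eqxx mul1n big1 ?addn0 // => k ne_ki.
by rewrite count_nseq /= (negPf ne_ki).
Qed.

Lemma sorted_normal w : sorted (@letter_le _) w ->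
    (forall i, count_mem i w < p ^ n)%N ->
  exists r, w = normal_word r.
Proof.
move=> w_s lt_w; exists [ffun i => Ordinal (lt_w i)].
apply: sorted_word_eq => //; first exact: normal_word_sorted.
apply/allP=> i _; apply/eqP.
by rewrite /= count_normal_word ffunE.
Qed.

(** A sorted word with an exponent at least p^n is reduced, by the relation for that letter, to
    shorter sorted words. *)
Lemma reduced_eq0 phi : bracket phi -> ppoly_rel phi ->
  (forall r, phi (normal_word r) = 0) -> forall w, phi w = 0.
Proof.
move=> rel_phi pow_phi phi0; apply: (bracket_rel_eq0 rel_phi) => w.
have [s] := ubnP (size w); elim: s w => // s IHs w; rewrite ltnS => sz_w w_s.
have [lt_w|] := boolP [forall i, (count_mem i w < p ^ n)%N].
  by have [r ->] := sorted_normal w_s (forallP lt_w).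
rewrite negb_forall => /existsP[i]; rewrite -leqNgt => le_q.
pose u := word_lt w i; pose c := (count_mem i w - p ^ n)%N.
pose v := nseq c i ++ word_gt w i.
have Ew t : u ++ nseq t i ++ v = word_lt w i ++ nseq (t + c) i ++ word_gt w i.
  by rewrite nseqD -catA.
have sz t : size (u ++ nseq t i ++ v) = (t + size (u ++ v))%N.
  by rewrite !size_cat size_nseq addnCA.
have E : w = u ++ nseq (p ^ n) i ++ v by rewrite Ew subnKC // -sorted_wordE.
have small t : (t < p ^ n)%N -> phi (u ++ nseq t i ++ v) = 0.
  move=> lt_t; apply: IHs; last by rewrite Ew; apply: sorted_insert.
  by apply: leq_trans sz_w; rewrite [in X in (_ < X)%N]E !sz ltn_add2r.
(* Centrality moves P_i(x_i) from the front to just after [u]. Its top term is [w], since P_i is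
   monic; all other terms are shorter sorted words. *)
have := pow_phi i (u ++ v).
rewrite (insert_ppoly_cat pcharFp basisX ad_l) //= /insert_ppoly big_ord_recr /=.
rewrite l_n mul1r -E big1 => [|j _].
  by rewrite add0r => ->; apply: (small 0); rewrite expn_gt0 ltnW.
by rewrite small ?mulr0 // ltn_exp2l.
Qed.

(** Products of one-variable solutions satisfy the recurrences in all exponents at once; the
    combination is the one that agrees with [g] on exponents below p^n. *)
Definition weight_sum g w : F :=
  \sum_r g r * \prod_i weight p n (l i) (r i) (count_mem i w).

Definition extension g : word -> F :=
  pbw_extension (structure_const X) (weight_sum g).

Lemma extension_bracket g : bracket (extension g).
Proof.
apply: pbw_extension_rel; first exact: structure_const_alt.
- exact: structure_const_anti.
- exact: structure_const_jacobi.
Qed.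

Lemma weight_sum_ppoly g i u v :
  \sum_(j < n.+1) l i j * weight_sum g (u ++ nseq (p ^ j) i ++ v) =
  weight_sum g (u ++ v).
Proof.
rewrite /weight_sum; under eq_bigr do rewrite mulr_sumr.
rewrite exchange_big /=; apply: eq_bigr => r _.
under eq_bigr do rewrite mulrCA; rewrite -mulr_sumr; congr (_ * _).
rewrite [RHS](bigD1 i) //= -weight_rec // mulr_suml; apply: eq_bigr => j _.
rewrite (bigD1 i) //= -mulrA; congr (_ * (_ * _)).
  by rewrite !count_cat count_nseq /= eqxx mul1n addnCA addnC.
apply: eq_bigr => k ne_ki.
by rewrite !count_cat count_nseq /= [i == k]eq_sym (negPf ne_ki).
Qed.

(** The difference of the two sides again satisfies the bracket relation, so sorted words suffice.
    There centrality moves P_i(x_i) into the block of [i], all words stay sorted, and the claim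
    becomes the recurrence for [weight_sum]. *)
Lemma extension_ppoly g : ppoly_rel (extension g).
Proof.
move=> i w; apply/eqP; rewrite -subr_eq0; apply/eqP; move: w.
have rel_g := extension_bracket g.
apply: bracket_rel_eq0 => [u a b v|w w_s].
  rewrite /bracket_rel_at /insert_ppoly /=.
  under eq_bigr do rewrite catA rel_g mulrDr -!catA.
  rewrite big_split /= rel_g opprD addrACA; congr (_ + _).
  rewrite /insert_vec; under [RHS]eq_bigr do rewrite mulrBr.
  rewrite sumrB; congr (_ - _).
  under eq_bigr do rewrite mulr_sumr; rewrite exchange_big /=.
  apply: eq_bigr => k _; rewrite mulr_sumr; apply: eq_bigr => j _.
  by rewrite mulrCA catA.
apply/eqP; rewrite subr_eq0; apply/eqP.
have E := sorted_wordE i w_s.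
pose v := nseq (count_mem i w) i ++ word_gt w i.
rewrite {1}E (insert_ppoly_cat pcharFp basisX ad_l) //= -/v /insert_ppoly.
have ext_s t : extension g (word_lt w i ++ nseq t i ++ v) =
    weight_sum g (word_lt w i ++ nseq t i ++ v).
  apply: pbw_extension_sorted; rewrite /v [nseq t i ++ _]catA -nseqD.
  exact: sorted_insert.
under eq_bigr do rewrite ext_s.
by rewrite weight_sum_ppoly -[LHS](ext_s 0) -E.
Qed.

Lemma extension_normal g r : extension g (normal_word r) = g r.
Proof.
rewrite /extension pbw_extension_sorted ?normal_word_sorted //.
rewrite /weight_sum (bigD1 r) //= [X in _ * X]big1 ?mulr1 => [|i _]; last first.
  by rewrite count_normal_word weight_small ?eqxx.
rewrite big1 ?addr0 // => r' ne_r.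
have /existsP[i ne_i] : [exists i, r' i != r i].
  rewrite -negb_forall; apply: contra ne_r => /forallP eq_r.
  by apply/eqP/ffunP=> i; apply/eqP.
rewrite (bigD1 i) //= count_normal_word weight_small //.
by rewrite (negPf ne_i : (r' i == r i :> nat) = false) mul0r mulr0.
Qed.

Lemma extension_unique phi : bracket phi -> ppoly_rel phi ->
  forall w, extension [ffun r => phi (normal_word r)] w = phi w.
Proof.
move=> rel_phi pow_phi w; apply/eqP; rewrite -subr_eq0; apply/eqP; move: w.
set g := [ffun r => _]; have rel_g := extension_bracket g.
apply: reduced_eq0 => [u a b v|i w|r].
- rewrite /bracket_rel_at rel_g rel_phi opprD addrACA; congr (_ + _).
  by rewrite /insert_vec -sumrB; apply: eq_bigr => k _; rewrite mulrBr.
- rewrite -[in RHS](extension_ppoly g i) -[in RHS](pow_phi i) -sumrB.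
  by apply: eq_bigr => j _; rewrite mulrBr.
- by rewrite extension_normal ffunE subrr.
Qed.

Lemma extension_linear a g h w :
  extension (a *: g + h) w = a * extension g w + extension h w.
Proof.
have rel_g := extension_bracket g; have rel_h := extension_bracket h.
have -> : a *: g + h =
    [ffun r => a * extension g (normal_word r) + extension h (normal_word r)].
  by apply/ffunP=> r; rewrite !ffunE !extension_normal.
rewrite (@extension_unique (fun w => a * extension g w + extension h w)) //.
- move=> u i j v; rewrite /bracket_rel_at rel_g rel_h mulrDr addrACA; congr (_ + _).
  rewrite /insert_vec mulr_sumr -big_split; apply: eq_bigr => k _ /=.
  by rewrite mulrDr mulrCA.
- move=> i {}w; rewrite -[in RHS](extension_ppoly g i) -[in RHS](extension_ppoly h i).
  rewrite mulr_sumr -big_split; apply: eq_bigr => j _ /=.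
  by rewrite mulrDr mulrCA.
Qed.

(** The action on functionals in coordinates on normal words. Appending at the right end gives a
    left action. *)
Definition letter_op i g : {ffun expo -> F^o} :=
  [ffun r => extension g (rcons (normal_word r) i)].

Lemma extension_letter_op i g w : extension (letter_op i g) w = extension g (rcons w i).
Proof.
have rel_g := extension_bracket g.
rewrite (@extension_unique (fun w => extension g (rcons w i))) //.
- move=> u a b v; rewrite /bracket_rel_at !rcons_cat /= rel_g; congr (_ + _).
  by apply: eq_bigr => k _; rewrite rcons_cat.
- move=> a {}w; rewrite -[in RHS](extension_ppoly g a).
  by apply: eq_bigr => j _; rewrite /= rcons_cat.
Qed.

Lemma letter_op_linear i : linear (letter_op i).
Proof. by move=> a g h; apply/ffunP=> r; rewrite !ffunE extension_linear. Qed.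

HB.instance Definition _ i :=
  GRing.isLinear.Build F _ _ _ (letter_op i) (letter_op_linear i).

Lemma letter_op_bracket i j g :
  letter_op i (letter_op j g) - letter_op j (letter_op i g) =
  \sum_k structure_const X i j k *: letter_op k g.
Proof.
apply/ffunP=> r; rewrite !ffunE sum_ffunE !extension_letter_op.
rewrite -!cats1 -!catA /= (extension_bracket g _ i j) addrAC subrr add0r.
by apply: eq_bigr => k _; rewrite !ffunE -cats1.
Qed.

(** Iterates of [letter_op] append at the end while [ppoly_rel] inserts at the front; centrality
    bridges the two. *)
Lemma letter_op_ppoly i g :
  \sum_(j < n.+1) l i j *: iter (p ^ j) (letter_op i) g = g.
Proof.
have ext_iter t w : extension (iter t (letter_op i) g) w = extension g (w ++ nseq t i).
  elim: t w => [|t IHt] w; first by rewrite cats0.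
  by rewrite iterS extension_letter_op IHt cat_rcons.
apply/ffunP=> r; rewrite sum_ffunE.
rewrite -[RHS]extension_normal -[RHS](extension_ppoly g i).
have := insert_ppoly_cat pcharFp basisX ad_l i [::] (normal_word r) [::]
  (extension_bracket g).
rewrite /= cats0 => ->; apply: eq_bigr => j _.
by rewrite ffunE -extension_normal ext_iter cats0.
Qed.

Notation redV := {ffun expo -> F^o}.

Definition reduced_repr (y : L) : 'End(redV) :=
  \sum_i coord X i y *: linfun (letter_op i).

Lemma reduced_repr_linear : linear reduced_repr.
Proof.
move=> a y z; rewrite /reduced_repr scaler_sumr -big_split; apply: eq_bigr => i _ /=.
by rewrite linearP scalerDl scalerA.
Qed.

HB.instance Definition _ :=
  GRing.isLinear.Build F _ _ _ reduced_repr reduced_repr_linear.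

Lemma reduced_repr_basis i : reduced_repr X`_i = linfun (letter_op i).
Proof.
rewrite /reduced_repr (bigD1 i) //= coord_basis_delta // eqxx scale1r.
rewrite big1 ?addr0 // => k ne_ki.
by rewrite coord_basis_delta // (negPf ne_ki) scale0r.
Qed.

Lemma reduced_repr_lie : lie_morphism reduced_repr.
Proof.
have lie_basis (i j : 'I_n.+1) : reduced_repr (lie X`_i X`_j) =
    lie (reduced_repr X`_i) (reduced_repr X`_j).
  rewrite !reduced_repr_basis; apply/lfunP=> g.
  rewrite lie_lfunE !lfunE /= letter_op_bracket /reduced_repr sum_lfunE.
  by apply: eq_bigr => k _; rewrite scale_lfunE lfunE.
move=> y z; rewrite {1}(basis_coord basisX y) {1}(basis_coord basisX z).
rewrite lie_suml linear_sum [X in lie (reduced_repr X) _](basis_coord basisX y).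
rewrite (linear_sum reduced_repr) lie_suml; apply: eq_bigr => i _ /=.
rewrite lieZl !linearZ /= lieZl; congr (_ *: _).
rewrite lie_sumr linear_sum [X in lie _ (reduced_repr X)](basis_coord basisX z).
rewrite (linear_sum reduced_repr) lie_sumr; apply: eq_bigr => j _ /=.
by rewrite lieZr !linearZ /= lieZr lie_basis.
Qed.

(** If x_i killed U, so would P_i(x_i), every term of which has a positive power of x_i; but
    P_i(x_i) is the identity. *)
Lemma reduced_repr_neq0 i (U : {vspace redV}) :
  U != 0%VS -> (reduced_repr X`_i @: U)%VS != 0%VS.
Proof.
move=> U_neq0; apply/eqP => im0; move: U_neq0; rewrite -vpick0 => /eqP[].
have pick0 : letter_op i (vpick U) = 0.
  have := memv_img (reduced_repr X`_i) (memv_pick U).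
  by rewrite im0 memv0 reduced_repr_basis lfunE => /eqP.
rewrite -[LHS](letter_op_ppoly i) big1 // => j _.
have : (0 < p ^ j)%N by rewrite expn_gt0 ltnW.
case: (p ^ j)%N => // q _; rewrite iterSr pick0.
have -> : iter q (letter_op i) 0 = 0 by elim: q => //= q ->; rewrite linear0.
by rewrite scaler0.
Qed.

Lemma dim_reduced : \dim {: redV} = (p ^ (n * n.+1))%N.
Proof.
by rewrite dimvf /dim /= card_ffun !card_ord muln1 expnM.
Qed.

End Reduced.

Lemma basis_with (F : fieldType) (V : vectType F) n (x : V) :
    \dim {:V} = n.+1 -> x != 0 ->
  exists2 X : n.+1.-tuple V, basis_of fullv X & X`_0 = x.
Proof.
move=> dimV x_neq0; pose X := x :: vbasis (<[x]>^C)%VS.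
have basisX : basis_of fullv X.
  rewrite -(addv_complf <[x]>) /X -cat1s; apply: cat_basis.
  - by apply/directv_addP; rewrite capv_compl.
  - exact: seq1_basis.
  - exact: vbasisP.
have sz : size X == n.+1 
  by have := basis_free basisX; rewrite /free (span_basis basisX) dimV eq_sym.
by exists (Tuple sz).
Qed.

Lemma reduced_module (F : fieldType) p (L : finLieAlgType F) n (x : L) :
    p \in [pchar F] -> \dim {:L} = n.+1 -> x != 0 ->
  exists (V : vectType F) (rho : {linear L -> 'End(V)}),
    [/\ lie_morphism rho, \dim {:V} = (p ^ (n * n.+1))%N &
        forall U : {vspace V}, U != 0%VS -> (rho x @: U)%VS != 0%VS].
Proof.
move=> pcharFp dimL x_neq0; have [X basisX X0] := basis_with dimL x_neq0.
have [l l_n ad_l] := fin_all_exists2 (fun i : 'I_n.+1 =>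
  ad_ppoly X`_i pcharFp dimL).
pose rho : {linear L -> 'End(_)} := reduced_repr p X l.
exists _, rho; split.
- exact: reduced_repr_lie.
- exact: dim_reduced.
- move=> U; rewrite -X0; exact: (@reduced_repr_neq0 _ _ _ _ _ _ _ _ _ _ ord0).
Qed.

(** * Irreducible modules and direct sums *)

Section Intertwiner.
Variables (F : fieldType) (L : lieAlgType F) (V W : vectType F).
Variables (rhoW : L -> 'End(W)) (rhoV : L -> 'End(V)) (f : 'Hom(W, V)).
Hypothesis f_inj : lker f == 0%VS.
Hypothesis f_comm : forall x w, f (rhoW x w) = rhoV x (f w).
Implicit Types Y Z : {vspace W}.

Lemma limg_intertwine x Y : (rhoV x @: (f @: Y) = f @: (rhoW x @: Y))%VS.
Proof.
rewrite -!limg_comp; congr (lfun_img _ _); apply/lfunP=> w.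
by rewrite !comp_lfunE f_comm.
Qed.

Lemma limg_eq Y Z : (f @: Y = f @: Z)%VS -> Y = Z.
Proof.
by move=> eq_f; apply/eqP; rewrite eqEsubv -!(limg_ker0 _ _ f_inj) eq_f subvv.
Qed.

Lemma submodule_img Y : submodule rhoW Y <-> submodule rhoV (f @: Y)%VS.
Proof.
split=> subY x; first by rewrite limg_intertwine limgS.
by rewrite -(limg_ker0 _ _ f_inj) -limg_intertwine.
Qed.

(** Serves both the inclusion of a submodule and the two injections into a direct sum. *)
Lemma irreducible_img Y :
  irreducible_submodule rhoW Y <-> irreducible_submodule rhoV (f @: Y)%VS.
Proof.
have img0 : (f @: 0 = 0)%VS by rewrite limg0.
split=> -[subY Y_neq0 minY]; split.
- exact/submodule_img.
- by apply: contra_neq Y_neq0; rewrite -{1}img0 => /limg_eq.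
- move=> Z subZ Z_Y; have E : Z = (f @: (f @^-1: Z))%VS.
    by rewrite lpreimK // (subv_trans Z_Y) // limgS // subvf.
  have sub_preim : (f @^-1: Z <= Y)%VS by rewrite -(limg_ker0 _ _ f_inj) -E.
  rewrite E; case: (minY (f @^-1: Z)%VS) => // [|->|->]; [|left|right] => //.
  by apply/submodule_img; rewrite -E.
- exact/submodule_img.
- by apply: contra_neq Y_neq0 => ->.
- move=> Z subZ Z_Y.
  have := minY (f @: Z)%VS (proj1 (submodule_img Z) subZ) (limgS f Z_Y).
  by case=> [|/limg_eq ->]; [rewrite -{1}img0 => /limg_eq ->; left | right].
Qed.
End Intertwiner.

(** A nonzero submodule of least dimension; excluded middle decides whether a smaller one exists. *)
Lemma exists_irreducible (F : fieldType) (L : lieAlgType F) (V : vectType F)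
    (rho : L -> 'End(V)) (U : {vspace V}) :
    submodule rho U -> U != 0%VS ->
  exists W, irreducible_submodule rho W.
Proof.
have [s] := ubnP (\dim U); elim: s U => // s IHs U dimU subU U_neq0.
have [[W [subW W_neq0 lt_W]]|no_W] := classic (exists W : {vspace V},
    [/\ submodule rho W, W != 0%VS & (\dim W < \dim U)%N]).
  by apply: (IHs W) => //; apply: leq_trans lt_W _.
exists U; split=> // W subW W_U; have [->|W_neq0] := eqVneq W 0%VS; first by left.
right; apply/eqP; rewrite eqEdim W_U leqNgt /=; apply/negP=> lt_W.
by apply: no_W; exists W.
Qed.

Section Restriction.
Variables (F : fieldType) (L : lieAlgType F) (V : vectType F).
Variables (rho : {linear L -> 'End(V)}) (U : {vspace V}).

(** [vsproj] makes this total; it is the restriction of [rho x] once U is stable. *)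
Definition restrict_act x (u : subvs_of U) : subvs_of U := vsproj U (rho x (vsval u)).

Fact restrict_act_linear x : linear (restrict_act x).
Proof. by move=> a u v; rewrite /restrict_act !linearP. Qed.

HB.instance Definition _ x :=
  GRing.isLinear.Build F _ _ _ (restrict_act x) (restrict_act_linear x).

Definition restrict_repr x : 'End(subvs_of U) := linfun (restrict_act x).

Fact restrict_repr_linear : linear restrict_repr.
Proof.
move=> a x y; apply/lfunP=> u.
rewrite /restrict_repr add_lfunE scale_lfunE !lfunE /= /restrict_act.
by rewrite linearP add_lfunE scale_lfunE linearP.
Qed.

HB.instance Definition _ :=
  GRing.isLinear.Build F _ _ _ restrict_repr restrict_repr_linear.

Hypothesis subU : submodule rho U.

Lemma restrict_reprE x u : vsval (restrict_repr x u) = rho x (vsval u).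
Proof.
rewrite /= /restrict_repr lfunE /= vsprojK //.
by apply: (subvP (subU x)); apply: memv_img; apply: subvsP.
Qed.

Lemma restrict_lie : lie_morphism rho -> lie_morphism restrict_repr.
Proof.
move=> rho_lie x y; apply/lfunP=> u; apply: val_inj => /=.
by rewrite lie_lfunE restrict_reprE rho_lie lie_lfunE linearB /= !restrict_reprE.
Qed.

Lemma restrict_irreducible :
  irreducible_submodule rho U -> irreducible_submodule restrict_repr fullv.
Proof.
pose f : 'Hom(subvs_of U, V) := linfun vsval.
have f_inj : lker f == 0%VS.
  by apply/lker0P=> u v; rewrite !lfunE; apply: val_inj.
have img_f : (f @: fullv)%VS = U.
  apply/vspaceP=> v; apply/memv_imgP/idP=> [[u _ ->]|Uv].
    by rewrite lfunE; apply: subvsP.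
  by exists (vsproj U v); rewrite ?memvf // lfunE /= vsprojK.
rewrite -{1}img_f => irrU; apply/(irreducible_img f_inj) => [x u|]; last exact: irrU.
by rewrite ![f _]lfunE /= restrict_reprE.
Qed.

Lemma restrict_neq0 x : (rho x @: U != 0)%VS -> restrict_repr x != 0.
Proof.
apply: contra_neq => rx0; apply/eqP; rewrite -subv0; apply/subvP=> _ /memv_imgP[u Uu ->].
have := restrict_reprE x (vsproj U u).
by rewrite rx0 lfunE vsprojK // /= => <-; rewrite mem0v.
Qed.
End Restriction.

Lemma simple_module (F : fieldType) p (L : finLieAlgType F) n (x : L) :
    p \in [pchar F] -> \dim {:L} = n.+1 -> x != 0 ->
  exists (V : vectType F) (rho : {linear L -> 'End(V)}),
    [/\ lie_morphism rho, irreducible_submodule rho fullv, rho x != 0 &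
        (\dim {:V} <= p ^ (n * n.+1))%N].
Proof.
move=> pcharFp dimL x_neq0.
have [V [rho [rho_lie dimV rho_x]]] := reduced_module pcharFp dimL x_neq0.
have V_neq0 : fullv != 0%VS :> {vspace V}.
  by rewrite -dimv_eq0 dimV -lt0n expn_gt0 prime_gt0 // (pcharf_prime pcharFp).
have [U irrU] : exists U, irreducible_submodule rho U.
  by apply: (exists_irreducible _ V_neq0) => y; apply: subvf.
have [subU U_neq0 _] := irrU.
exists (subvs_of U), (restrict_repr rho U); split.
- exact: restrict_lie.
- exact: restrict_irreducible.
- exact/restrict_neq0/rho_x.
- by rewrite -dimV [leqLHS]dimvf dimvS ?subvf.
Qed.

(** * Direct sum of two modules *)

Section DirectSum.
Variables (F : fieldType) (L : lieAlgType F) (V W : vectType F).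

Section Act.
Variables (f : 'End(V)) (g : 'End(W)).

Definition sum_act (u : V * W) : V * W := (f u.1, g u.2).

Fact sum_act_linear : linear sum_act.
Proof. by move=> a u v; rewrite /sum_act /= !linearP. Qed.

HB.instance Definition _ :=
  GRing.isLinear.Build F _ _ _ sum_act sum_act_linear.
End Act.

Definition inl_act (v : V) : V * W := (v, 0).
Definition inr_act (w : W) : V * W := (0, w).

Fact inl_act_linear : linear inl_act.
Proof.
by move=> a u v; apply/eqP; rewrite xpair_eqE /= scaler0 addr0 !eqxx.
Qed.

Fact inr_act_linear : linear inr_act.
Proof.
by move=> a u v; apply/eqP; rewrite xpair_eqE /= scaler0 addr0 !eqxx.
Qed.

HB.instance Definition _ :=
  GRing.isLinear.Build F _ _ _ inl_act inl_act_linear.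
HB.instance Definition _ :=
  GRing.isLinear.Build F _ _ _ inr_act inr_act_linear.

Variables (rhoV : {linear L -> 'End(V)}) (rhoW : {linear L -> 'End(W)}).

Definition sum_repr x : 'End((V * W)%type) := linfun (sum_act (rhoV x) (rhoW x)).

Lemma sum_reprE x u : sum_repr x u = (rhoV x u.1, rhoW x u.2).
Proof. by rewrite /sum_repr lfunE. Qed.

Fact sum_repr_linear : linear sum_repr.
Proof.
move=> a x y; apply/lfunP=> u; rewrite add_lfunE scale_lfunE !sum_reprE !linearP.
by rewrite !add_lfunE !scale_lfunE.
Qed.

HB.instance Definition _ :=
  GRing.isLinear.Build F _ _ _ sum_repr sum_repr_linear.

Lemma sum_repr_lie :
  lie_morphism rhoV -> lie_morphism rhoW -> lie_morphism sum_repr.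
Proof.
move=> lieV lieW x y; apply/lfunP=> u; rewrite lie_lfunE !sum_reprE /=.
by rewrite lieV lieW !lie_lfunE.
Qed.

Lemma dim_pair : \dim {: (V * W)%type} = (\dim {:V} + \dim {:W})%N.
Proof. by rewrite !dimvf. Qed.

Lemma sum_completely_reducible :
    completely_reducible rhoV -> irreducible_submodule rhoW fullv ->
  completely_reducible sum_repr.
Proof.
move=> [m [U [irrU dirU sumU]]] irrW.
pose il : 'Hom(V, (V * W)%type) := linfun inl_act.
pose ir : 'Hom(W, (V * W)%type) := linfun inr_act.
have il_inj : lker il == 0%VS by apply/lker0P=> u v; rewrite !lfunE => -[].
have ir_inj : lker ir == 0%VS by apply/lker0P=> u v; rewrite !lfunE => -[].
have il_comm x v : il (rhoV x v) = sum_repr x (il v).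
  by rewrite sum_reprE ![il _]lfunE /= linear0.
have ir_comm x w : ir (rhoW x w) = sum_repr x (ir w).
  by rewrite sum_reprE ![ir _]lfunE /= linear0.
(* Index 0 carries the new summand W, the lifted indices those of V. *)
pose U' (i : 'I_m.+1) :=
  if unlift ord0 i is Some j then (il @: U j)%VS else (ir @: fullv)%VS.
have sumU' : (\sum_(i < m.+1) U' i)%VS = fullv.
  rewrite big_ord_recl /U' unlift_none.
  under eq_bigr do rewrite liftK.
  rewrite -limg_sum sumU; apply/eqP; rewrite eqEsubv subvf; apply/subvP=> -[v w] _.
  have -> : (v, w) = ir w + il v.
    by rewrite !lfunE; apply/eqP; rewrite xpair_eqE /= add0r addr0 !eqxx.
  by apply: memv_add; apply: memv_img; apply: memvf.
have dim_il Y : \dim (il @: Y) = \dim Y.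
  by apply: limg_dim_eq; rewrite (eqP il_inj) capv0.
have dim_ir Y : \dim (ir @: Y) = \dim Y.
  by apply: limg_dim_eq; rewrite (eqP ir_inj) capv0.
exists m.+1, U'; split=> // [i|].
  rewrite /U'; case: unliftP => [j _|_].
    by apply/(irreducible_img il_inj il_comm).
  by apply/(irreducible_img ir_inj ir_comm).
rewrite directvE /= sumU' big_ord_recl {1}/U' unlift_none dim_ir dim_pair addnC.
rewrite -sumU (eqP dirU) /=; apply/eqP; congr (_ + _)%N.
by apply: eq_bigr => i _; rewrite /U' liftK dim_il.
Qed.

End DirectSum.

(** * Faithfulness and the dimension bound *)

(** While the kernel is nonzero, add a simple module on which some x of the kernel acts
    nontrivially: the kernel loses at least one dimension and the module gains at most [B]. *)
Lemma completely_reducible_small_kernel (F : fieldType) (L : finLieAlgType F) B :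
    (forall x : L, x != 0 ->
      exists (V : vectType F) (rho : {linear L -> 'End(V)}),
        [/\ lie_morphism rho, irreducible_submodule rho fullv, rho x != 0 &
            (\dim {:V} <= B)%N]) ->
  forall d, exists (V : vectType F) (rho : {linear L -> 'End(V)}),
    [/\ lie_morphism rho, completely_reducible rho,
        (\dim (lker (linfun rho)) <= \dim {:L} - d)%N & (\dim {:V} <= d * B)%N].
Proof.
move=> simpleL; elim=> [|d [V [rho [rho_lie rho_cr ker_rho dimV]]]].
  pose V := 'rV[F]_0.
  have dimV : \dim {:V} = 0%N by rewrite dimvf /dim /= muln0.
  exists V, (\0 : {linear L -> 'End(V)}); split.
  - by move=> x y; apply/lfunP=> v; rewrite lie_lfunE !lfunE subrr.
  - exists 0%N, (fun i => fullv); split=> [[]//||].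
      by rewrite directvE /= !big_ord0 dimv0.
    by rewrite big_ord0; apply/esym/eqP; rewrite -dimv_eq0 dimV.
  - by rewrite subn0 dimvS ?subvf.
  - by rewrite dimV.
(* Once the kernel is 0, the module is kept and only the bounds are relaxed. *)
have [ker0|ker_neq0] := eqVneq (lker (linfun rho)) 0%VS.
  exists V, rho; split=> //; first by rewrite ker0 dimv0.
  by apply: leq_trans dimV _; rewrite leq_mul.
pose x := vpick (lker (linfun rho)).
have x_neq0 : x != 0 by rewrite vpick0.
have x_ker : x \in lker (linfun rho) by apply: memv_pick.
have [W [sigma [sigma_lie sigma_irr sigma_x dimW]]] := simpleL x x_neq0.
exists (V * W)%type, (sum_repr rho sigma); split.
- exact: sum_repr_lie.
- exact: sum_completely_reducible.
- rewrite subnS -ltnS; apply: leq_trans (_ : (_ < \dim (lker (linfun rho)))%N) _.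
    have sub_ker : (lker (linfun (sum_repr rho sigma)) <= lker (linfun rho))%VS.
      apply/subvP=> y; rewrite !memv_ker !lfunE /= => /eqP y0; apply/eqP/lfunP=> v.
      by have := congr1 (fun f : 'End(_) => (f (v, 0)).1) y0; rewrite sum_reprE !lfunE.
    rewrite ltnNge; apply: contra sigma_x => le_ker.
    have : x \in lker (linfun (sum_repr rho sigma)).
      by have /eqP-> : lker (linfun (sum_repr rho sigma)) == lker (linfun rho)
        by rewrite eqEdim sub_ker.
    rewrite memv_ker lfunE /= => /eqP x0; apply/eqP/lfunP=> w.
    by have := congr1 (fun f : 'End(_) => (f (0, w)).2) x0; rewrite sum_reprE !lfunE.
  have ker_gt0 : (0 < \dim (lker (linfun rho)))%N by rewrite lt0n dimv_eq0.
  by rewrite prednK // (leq_trans ker_gt0).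
- by rewrite dim_pair mulSn addnC leq_add.
Qed.

Theorem theorem1p1 (F : fieldType) (p : nat) (hp : p \in [pchar F])
    (n : nat) (L : finLieAlgType F) (hn : \dim {:L} = n) :
  exists (V : vectType F) (rho : {linear L -> 'End(V)}),
    [/\ lie_morphism rho, injective rho, completely_reducible rho &
        ((\dim {:V})%:R <= (p%:R : rat) ^ (n%:Z ^+ 2 - 1))].
Proof.
have p_gt1 := prime_gt1 (pcharf_prime hp).
have simpleL (x : L) : x != 0 ->
    exists (V : vectType F) (rho : {linear L -> 'End(V)}),
    [/\ lie_morphism rho, irreducible_submodule rho fullv, rho x != 0 &
        (\dim {:V} <= p ^ (n.-1 * n))%N].
  move=> x_neq0; case: n hn => [dimL|m dimL].
    case/negP: x_neq0; rewrite -memv0 -(_ : fullv = 0%VS) ?memvf //.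
    by apply/eqP; rewrite -dimv_eq0 dimL.
  exact: simple_module.
have [V [rho [rho_lie rho_cr ker_rho dimV]]] :=
  completely_reducible_small_kernel simpleL n.
exists V, rho; split=> //.
  have : lker (linfun rho) == 0%VS by rewrite -dimv_eq0 -leqn0 -(subnn n) -{1}hn.
  by move/lker0P => inj x y eq_xy; apply: inj; rewrite !lfunE.
case: n {hn simpleL ker_rho} dimV => [|m] dimV.
  (* For n = 0 the exponent is -1 and the bound 1/p, which the zero module meets. *)
  by move: dimV; rewrite mul0n leqn0 => /eqP->; rewrite exprz_ge0 // ler0n.
(* The factor p^m absorbs the number m + 1 of summands, as m < p^m. *)
have -> : m.+1%:Z ^+ 2 - 1 = (m + m * m.+1)%N%:Z.
  by lia.
rewrite -exprnP -natrX ler_nat expnD; apply: leq_trans dimV _.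
by rewrite leq_mul2r ltn_expl ?orbT.
Qed.
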